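(* Let $(F_n)_{n\ge 0}$ be the Fibonacci sequence. The triples of integers $(n,d,m)$ with $n\ge 1$, $d\ge 0$, $m\ge 1$ satisfying \[F_n^2+F_{n+d}^2=F_m\] are exactly \[(n,d,m)\in\{(1,2,5),\ (1,0,3),\ (2,0,3),\ (3,0,6)\}\cup\{(n,1,2n+1): n\ge 1\}.\]
   Context: The Fibonacci sequence is defined by $F_0=0$, $F_1=1$ and $F_{n+2}=F_{n+1}+F_n$ for $n\ge 0$. *)

(* Defs.v *)
From mathcomp Require Import all_boot.

(* Stdlib's Zgcd_alt.fibonacci is shifted by one (it starts 1, 1, 2),
   hence this definition with F_0 = 0 and F_1 = 1. *)
Fixpoint fib (n : nat) : nat :=
  match n with
  | 0 => 0
  | n1.+1 =>
      match n1 with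
      | 0 => 1
      | n2.+1 => fib n1 + fib n2
      end
  end.

(* Main.v *)
(* Write [N = n + d].  The addition formula gives [F_(2N-1) = F_N^2 + F_(N-1)^2]
   and [F_(2N-2) = F_N^2 - F_(N-2)^2].  When [d >= 1], [F_n^2 + F_N^2] thus lies in
   the interval ]F_(2N-2), F_(2N-1)], so it is a Fibonacci number only if
   [F_n = F_(N-1)].  When [d = 0] and [N > 3], [2 F_N^2] lies strictly between
   [F_(2N-1)] and [F_(2N) = 2 F_N^2 + F_N F_(N-3)]. *)
Require Import Defs.
From mathcomp Require Import all_boot zify.

Lemma fibSS n : fib n.+2 = fib n.+1 + fib n.
Proof. by []. Qed.

Lemma fib_gt0 n : 0 < n -> 0 < fib n.
Proof.
case: n => // n _; elim: n => // n IHn.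
by rewrite fibSS addn_gt0 IHn.
Qed.

Lemma leq_fib : {homo fib : m n / m <= n}.
Proof.
apply: homo_leq => [//|n m p|[|n]] //; first exact: leq_trans.
by rewrite fibSS leq_addr.
Qed.

(** The bound [1 < m] excludes [fib 1 = fib 2], the only repeated value. *)
Lemma ltn_fib m n : 1 < m -> m < n -> fib m < fib n.
Proof.
case: m => [|[|m]] // _ lt_mn; apply: leq_trans (leq_fib _ _ lt_mn).
by rewrite (fibSS m.+1) -addn1 leq_add2l fib_gt0.
Qed.

Lemma fib_not_between a m : fib a < fib m -> fib m < fib a.+1 -> False.
Proof.
move=> lo hi; case: (leqP m a) => [/leq_fib|/leq_fib]; lia.
Qed.

Lemma fib_inj m n : 1 < m -> 1 < n -> fib m = fib n -> m = n.
Proof.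
move=> m1 n1 eqF; case: (ltngtP m n) => // lt_mn.
  by have := ltn_fib _ _ m1 lt_mn; rewrite eqF ltnn.
by have := ltn_fib _ _ n1 lt_mn; rewrite eqF ltnn.
Qed.

(** Moving a unit from [m] to [n] preserves the left side, so the induction on [m] keeps [n]
    general. *)
Lemma fibD m n : fib (m + n).+1 = fib m.+1 * fib n.+1 + fib m * fib n.
Proof.
elim: m n => [|m IHm] n; first by rewrite mul1n mul0n addn0.
by rewrite addSnnS IHm !fibSS; lia.
Qed.

Lemma fib_double_succ n : fib (2 * n).+1 = fib n.+1 ^ 2 + fib n ^ 2.
Proof. by rewrite mul2n -addnn fibD -!mulnn. Qed.

Lemma fib_double n : fib (2 * n.+1) = fib n.+1 ^ 2 + 2 * (fib n.+1 * fib n).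
Proof.
have -> : 2 * n.+1 = (n.+1 + n).+1 by lia.
by rewrite fibD fibSS; lia.
Qed.

(** Case [d >= 1], with [k.+1] as [N]: positivity of [fib n] gives the strict lower bound,
    [fib n <= fib k] the upper one. *)
Lemma fib_sum_sq_eq n k m : 0 < n <= k ->
  fib n ^ 2 + fib k.+1 ^ 2 = fib m -> m = (2 * k).+1 /\ fib n = fib k.
Proof.
case: k => [|k] /andP[n0 le_nk]; first by lia.
have Fn0 := fib_gt0 _ n0; have leF := leq_fib _ _ le_nk => eqm.
have lo : fib (2 * k.+1) < fib m by rewrite -eqm fib_double fibSS; nia.
have hi : fib m <= fib (2 * k.+1).+1 by rewrite -eqm fib_double_succ; nia.
have eqF : fib m = fib (2 * k.+1).+1.
  by apply/eqP; rewrite eqn_leq hi leqNgt; apply/negP => /(fib_not_between _ _ lo).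
split; last by move: eqF; rewrite -eqm fib_double_succ; nia.
(* If [m <= 1], then [fib m <= 1], against [lo]. *)
apply: fib_inj eqF => //; rewrite ltnNge; apply/negP => /leq_fib.
have := fib_gt0 (2 * k.+1) isT; rewrite [fib 1]/=; lia.
Qed.

Lemma fib_neq_double_sq n m : 3 < n -> 2 * fib n ^ 2 <> fib m.
Proof.
case: n => [|[|[|[|n]]]] // _ eqm.
(* The index is now [n.+4], so this is [F_(N-3) > 0], which makes both bounds strict. *)
have F0 := fib_gt0 n.+1 isT.
apply: (fib_not_between (2 * n.+3).+1 m); rewrite -eqm.
  by rewrite fib_double_succ !fibSS; nia.
have -> : (2 * n.+3).+2 = 2 * n.+4 by lia.
by rewrite fib_double !fibSS; nia.
Qed.

Theorem theorem3p2 (n d m : nat) :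
  (1 <= n /\ 0 <= d /\ 1 <= m /\ fib n ^ 2 + fib (n + d) ^ 2 = fib m) <->
  ((n, d, m) \in [:: (1, 2, 5); (1, 0, 3); (2, 0, 3); (3, 0, 6)] \/
   exists k : nat, 1 <= k /\ (n, d, m) = (k, 1, 2 * k + 1)).
Proof.
split; last first.
  case=> [|[k [k0 [-> -> ->]]]].
    by rewrite !inE => /or4P[] /eqP[-> -> ->].
  by rewrite !addn1 fib_double_succ addnC.
case=> n0 [_ [m0]]; case: d => [|d].
  rewrite addn0 addnn -mul2n => eqm; left.
  case: (leqP n 3) => [n3|/fib_neq_double_sq/(_ eqm)//].
  have m1 : 1 < m.
    by case: m m0 eqm => [|[|m]] // _; have := fib_gt0 _ n0; rewrite [fib 1]/=; nia.
  (* The values [2 * fib n ^ 2] are 2, 2, 8, that is [fib 3], [fib 3], [fib 6]. *)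
  case: n n0 n3 eqm => [|[|[|[|n]]]] // _ _ eqm.
  - by rewrite (fib_inj m 3 m1 isT (esym eqm)).
  - by rewrite (fib_inj m 3 m1 isT (esym eqm)).
  - by rewrite (fib_inj m 6 m1 isT (esym eqm)).
rewrite addnS => eqm.
have [|-> eqF] := fib_sum_sq_eq n (n + d) m _ eqm; first by rewrite n0 leq_addr.
(* The difference is [d.+1] here, so [d = 0] is the infinite family; otherwise [eqF] is a repeated
   value, forcing [fib 1 = fib 2]. *)
case: d eqF {eqm} => [|d] eqF.
  by right; exists n; rewrite addn0 addn1.
case: (ltngtP n 1) => [|n1|n1]; first by lia.
  by have /eqP := fib_inj _ _ n1 (ltn_addr _ n1) eqF; rewrite -{1}[n]addn0 eqn_add2l.
move: eqF; rewrite n1 add1n; case: d => [|d] // eqF; first by left.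
by have := ltn_fib 2 d.+3 isT isT; rewrite -eqF.
Qed.
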